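(* Let $(X_k)_{k\in\mathbb{Z}}$ be a strictly stationary homogeneous Markov chain of square-integrable real random variables, standardized so that $E(X_k)=0$ and $E(X_k^2)=1$. Put $r_k=E(X_0X_k)$ and $r=r_1$, and assume $r\neq 0$ and $2|r|<1+r_2$. Suppose that there are a symmetric linear polynomial $L(x,y)=a(x+y)+b$ and a symmetric quadratic polynomial $Q(x,y)=A(x^2+y^2)+Bxy+C+D(x+y)$ with real coefficients such that, for all $k\in\mathbb{Z}$, almost surely $$E(X_k\mid X_{k-1},X_{k+1})=L(X_{k-1},X_{k+1}),\qquad E(X_k^2\mid X_{k-1},X_{k+1})=Q(X_{k-1},X_{k+1}).$$ Then the coefficients of $Q$ satisfy $D=0$ and at least one of $$A\left(r^2+\frac{1}{r^2}\right)+B=1\qquad\text{or}\qquad 2A+Br^2=1.$$ Here, when the polynomial $Q$ for which the identity $E(X_k^2\mid X_{k-1},X_{k+1})=Q(X_{k-1},X_{k+1})$ holds is not unique, the conclusion means that there is a polynomial $Q$ of the form $Q(x,y)=A(x^2+y^2)+Bxy+C+D(x+y)$ with real coefficients $A,B,C,D$ for which that identity holds (for all $k\in\mathbb{Z}$) and whose coefficients satisfy $D=0$ and at least one of the two equations $A\left(r^2+\frac{1}{r^2}\right)+B=1$, $2A+Br^2=1$.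
   Context: Equalities of conditional expectations are understood almost surely. ''Quadratic polynomial'' refers to any polynomial of the form $A(x^2+y^2)+Bxy+C+D(x+y)$, with arbitrary real coefficients $A,B,C,D$ (possibly zero). *)

(* Defs.v *)
From HB Require Import structures.
From mathcomp Require Import all_boot all_order all_algebra.
From mathcomp Require Import all_classical all_reals all_analysis.

Set Implicit Arguments.
Unset Strict Implicit.
Unset Printing Implicit Defensive.

Import Order.TTheory GRing.Theory Num.Theory.
Import numFieldNormedType.Exports.

Local Open Scope classical_set_scope.
Local Open Scope ring_scope.

Definition gen_sigma d (T : measurableType d) (R : realType)
    (X : int -> T -> R) (J : set int) : set (set T) :=
  <<s \bigcup_(j in J) g_sigma_algebra_preimage (X j) >>.

(* [is_cond_exp P G Y Z] means E(Y | G) = Z almost surely, for a sub-sigma-algebra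
   G and Z measurable with respect to G. *)
Definition is_cond_exp d (T : measurableType d) (R : realType)
    (P : probability T R) (G : set (set T)) (Y Z : T -> R) : Prop :=
  [/\ P.-integrable setT (EFin \o Y),
      P.-integrable setT (EFin \o Z),
      forall B : set R, measurable B -> G (Z @^-1` B)
    & forall A : set T, G A ->
        (\int[P]_(w in A) (Z w)%:E = \int[P]_(w in A) (Y w)%:E)%E ].

Definition strictly_stationary d (T : measurableType d) (R : realType)
    (P : probability T R) (X : int -> {RV P >-> R}) : Prop :=
  forall (n : nat) (t : n.-tuple int) (h : int) (B : set (n.-tuple R)),
    measurable B ->
    P [set w | B [tuple X (tnth t i + h) w | i < n]] =
    P [set w | B [tuple X (tnth t i) w | i < n]].

(* P(X_(n+1) \in B | X_j, j <= n) = kappa(X_n, B) a.s., where the transition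
   kernel kappa does not depend on n. *)
Definition homogeneous_markov_chain d (T : measurableType d) (R : realType)
    (P : probability T R) (X : int -> {RV P >-> R}) : Prop :=
  exists kappa : R.-pker R ~> R,
    forall (n : int) (B : set R), measurable B ->
      is_cond_exp P (gen_sigma X [set j | j <= n])
        (\1_(X (n + 1) @^-1` B)) (fun w => fine (kappa (X n w) B)).

(* The value is meaningful when X_0 * X_k is integrable, as it is for
   square-integrable variables. *)
Definition corr d (T : measurableType d) (R : realType)
    (P : probability T R) (X : int -> {RV P >-> R}) (k : int) : R :=
  fine ('E_P[(fun w => X 0 w * X k w)%R])%E.

Definition sym_lin (R : realType) (a b x y : R) : R := a * (x + y) + b.

Definition sym_quad (R : realType) (A B C D x y : R) : R :=
  A * (x ^+ 2 + y ^+ 2) + B * x * y + C + D * (x + y).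

(* E(X_k ^ m | X_(k-1), X_(k+1)) = f(X_(k-1), X_(k+1)) a.s., for all k. *)
Definition two_sided_regression d (T : measurableType d) (R : realType)
    (P : probability T R) (X : int -> {RV P >-> R}) (m : nat)
    (f : R -> R -> R) : Prop :=
  forall k : int,
    is_cond_exp P (gen_sigma X [set k - 1; k + 1])
      (fun w => X k w ^+ m) (fun w => f (X (k - 1) w) (X (k + 1) w)).

(* Main.v *)
Require Import Defs.
From HB Require Import structures.
From mathcomp Require Import all_boot all_order all_algebra.
From mathcomp Require Import all_classical all_reals all_analysis.
From mathcomp Require Import measurable_realfun ring lra.

Set Implicit Arguments.
Unset Strict Implicit.
Unset Printing Implicit Defensive.

Import Order.TTheory GRing.Theory Num.Theory.
Import numFieldNormedType.Exports.

Local Open Scope classical_set_scope.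
Local Open Scope ring_scope.

(** Put r = E(X_0 X_1), and write F_n for the sigma-algebra of the past
   (X_j, j <= n).

   Linear part. The offset of L vanishes because the chain is centred, and
   testing E(X_1 | X_0, X_2) = a (X_0 + X_2) against X_0 gives
   r = a (1 + r_2), so that 0 < 2 |a| < 1 by the assumption on r. Taking the
   conditional expectation given X_n only, and then using the Markov property,
   one finds E(X_(n+1) | F_n) = a (X_n + E(X_(n+2) | F_n)) for every n. Hence,
   for A in F_n, the numbers u_k = E(X_(n+k) 1_A) satisfy
   u_(k+1) = a (u_k + u_(k+2)).
   The solutions of this recurrence are spanned by rho^k and rho^-k with
   |rho| < 1, and u is bounded, so u_k = rho^k u_0. Therefore
   E(X_(n+1) | F_n) = rho X_n, whence rho = r and a (1 + r^2) = r.

   Quadratic part. Let q_k = E(X_k^2 | X_0). Computing E(X_1 X_2 | X_0) by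
   conditioning on (X_0, X_1) and on (X_0, X_2) gives
     (1 + r^2) q_1 = r^2 X_0^2 + q_2   (lemma regression_second_moments),
   and conditioning the quadratic regression on X_0 then gives
     (1 - A (1 + r^2)) q_1
       = (A - A r^2 + B r^2) X_0^2 + D (1 + r^2) X_0 + C
   (lemma regression_quadratic). Suppose 1, X_0, X_0^2 are linearly
   independent. If A (1 + r^2) = 1, the right-hand side vanishes identically,
   and 2A + B r^2 = 1, D = 0 follow. Otherwise q_1 = al X_0^2 + be X_0 + ga; the
   Markov property yields q_2 = al q_1 + be r X_0 + ga, and the first identity
   becomes an identity between polynomials in X_0, which forces al = 1 or
   al = r^2, and be = 0. The two values of al are the two alternatives of the
   theorem (lemma quadratic_coefficients).

   If 1, X_0, X_0^2 are dependent, then X_n^2 = c X_n + 1 for all n by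
   stationarity, and the first identity reads c r (1 - r)^2 X_0 = 0. So c = 0
   and X_n^2 = 1, and the polynomial (x^2 + y^2) / 2 is a regression polynomial
   with D = 0 and 2A + B r^2 = 1.

   Conditional expectations are handled throughout by their integrals over
   events; random variables are used as test functions by
   Rintegral_gen_sigma_test, and the passage from events of X_n to events of the
   whole past rests on markov_step. *)

(** * Integrals determined by their values on events *)

Section mixtures.
Context d (T : measurableType d) d' (Y : measurableType d') (R : realType).
Variable mu : {measure set T -> \bar R}.
Local Open Scope ereal_scope.
Import HBNNSimple.

(** The right-hand side involves the kernel k only through the integrals of
   k w U for measurable U, which is what makes a comparison of two kernels on
   events sufficient. *)
Lemma integral_mixtureE (k : T -> {measure set Y -> \bar R})
    (mk : forall U : set Y, measurable U ->
      measurable_fun [set: T] (fun w => k w U : \bar R))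
    (D : set T) (mD : measurable D)
    (f : Y -> \bar R) (f0 : forall y, 0 <= f y)
    (mf : measurable_fun [set: Y] f) :
  let s := nnsfun_approx measurableT mf in
  \int[mu]_(w in D) \int[k w]_y f y =
  limn (fun n => \sum_(r \in range (s n))
                   r%:E * \int[mu]_(w in D) k w (s n @^-1` [set r])).
Proof.
move=> s.
have ks w n : \int[k w]_y (s n y)%:E =
    \sum_(r \in range (s n)) r%:E * k w (s n @^-1` [set r]).
  by rewrite integralT_nnsfun sintegralE.
have mks n : measurable_fun [set: T] (fun w => \int[k w]_y (s n y)%:E).
  apply: measurable_fun_integral_kernel => //; first by move=> y;
    rewrite lee_fin.
  exact/measurable_EFinP.
transitivity (\int[mu]_(w in D) limn (fun n => \int[k w]_y (s n y)%:E)).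
  apply: eq_integral => w _; rewrite -monotone_convergence//; last 3 first.
  - by move=> n; exact/measurable_EFinP.
  - by move=> n y _; rewrite lee_fin.
  - by move=> y _ a b ab; rewrite lee_fin; exact/lefP/nd_nnsfun_approx.
  by apply: eq_integral => y _; apply/esym/cvg_lim => //;
    exact: cvg_nnsfun_approx.
rewrite monotone_convergence//; last 3 first.
- by move=> n; apply: measurable_funTS.
- by move=> n w _; apply: integral_ge0 => y _; rewrite lee_fin.
- move=> w _ a b ab; apply: ge0_le_integral => //.
  + by move=> y _; rewrite lee_fin.
  + exact/measurable_EFinP.
  + exact/measurable_EFinP.
  + by move=> y _; rewrite lee_fin; exact/lefP/nd_nnsfun_approx.
apply: congr_lim; apply/funext => n.
under eq_integral do rewrite ks.
rewrite ge0_integral_fsum//; last 2 first.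
- move=> r; apply: measurable_funeM; apply: measurable_funTS; exact: mk.
- move=> r w _; have [r0|r0] := leP 0%R r; first by rewrite mule_ge0// lee_fin.
  by rewrite preimage_nnfun0// measure0 mule0.
apply: eq_fsbigr => r; rewrite inE => -[y _ <-].
rewrite ge0_integralZl//; first by apply: measurable_funTS; exact: mk.
by rewrite lee_fin.
Qed.

(** Two random measures with the same mean on every event have the same mean
   integral of every nonnegative function. It is used with Dirac masses, with
   weighted Dirac masses and with the transition kernel of the chain. *)
Lemma eq_integral_mixture (k1 k2 : T -> {measure set Y -> \bar R})
    (mk1 : forall U : set Y, measurable U ->
      measurable_fun [set: T] (fun w => k1 w U : \bar R))
    (mk2 : forall U : set Y, measurable U ->
      measurable_fun [set: T] (fun w => k2 w U : \bar R))
    (D : set T) (mD : measurable D) :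
  (forall U, measurable U ->
     \int[mu]_(w in D) k1 w U = \int[mu]_(w in D) k2 w U) ->
  forall f : Y -> \bar R, (forall y, 0 <= f y) -> measurable_fun [set: Y] f ->
  \int[mu]_(w in D) \int[k1 w]_y f y = \int[mu]_(w in D) \int[k2 w]_y f y.
Proof.
move=> k12 f f0 mf; rewrite !(integral_mixtureE _ _ f0 mf)//.
apply: congr_lim; apply/funext => n; apply: eq_fsbigr => r _.
by rewrite k12.
Qed.

End mixtures.

Section weighted_test.
Context d (T : measurableType d) d' (Y : measurableType d') (R : realType).
Variable mu : {measure set T -> \bar R}.
Variables (V : T -> Y) (mV : measurable_fun [set: T] V).

(** The weighted Dirac masses W1 w \d_(V w) and W2 w \d_(V w) are random measures
   with the same mean on events. *)
Lemma eq_integral_weighted (W1 W2 : T -> R) :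
  measurable_fun [set: T] W1 -> measurable_fun [set: T] W2 ->
  (forall w, 0 <= W1 w) -> (forall w, 0 <= W2 w) ->
  (forall U, measurable U -> \int[mu]_(w in V @^-1` U) (W1 w)%:E =
                             \int[mu]_(w in V @^-1` U) (W2 w)%:E)%E ->
  forall f : Y -> \bar R, (forall y, 0 <= f y)%E -> measurable_fun [set: Y] f ->
  (\int[mu]_w ((W1 w)%:E * f (V w)) = \int[mu]_w ((W2 w)%:E * f (V w)))%E.
Proof.
move=> mW1 mW2 W10 W20 W12 f f0 mf.
pose k (W : T -> R) (W0 : forall w, 0 <= W w) w : {measure set Y -> \bar R} :=
  mscale (NngNum (W0 w)) (dirac (V w)).
have kE W W0 w U : k W W0 w U = ((W w)%:E * (\1_(V @^-1` U) w)%:E)%E.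
  by rewrite /k /= /mscale/= diracE indicE /in_mem /= /in_set/=;
    congr (_ * _%:R%:E)%E; apply: asbool_equiv_eq.
have mk (W : T -> R) (W0 : forall w, 0 <= W w) : measurable_fun [set: T] W ->
    forall U : set Y, measurable U ->
      measurable_fun [set: T] (fun w => k W W0 w U).
  move=> mW U mU; under eq_fun do rewrite kE.
  apply: emeasurable_funM; apply/measurable_EFinP => //.
  by apply: measurable_indic; rewrite -[X in measurable X]setTI; exact: mV.
have kI (W : T -> R) (W0 : forall w, 0 <= W w) :
    (\int[mu]_w ((W w)%:E * f (V w)) = \int[mu]_w \int[k W W0 w]_y f y)%E.
  apply: eq_integral => w _; rewrite ge0_integral_mscale//=.
  by rewrite integral_dirac// diracT mul1e.
rewrite (kI _ W10) (kI _ W20).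
apply: eq_integral_mixture => //; [exact: mk|exact: mk|].
move=> U mU.
under eq_integral do rewrite kE.
under [RHS]eq_integral do rewrite kE.
have mVU : measurable (V @^-1` U) by rewrite -[X in measurable X]setTI;
  exact: mV.
have := W12 U mU.
rewrite integral_mkcond [in RHS]integral_mkcond !epatch_indic.
by [].
Qed.

End weighted_test.

Section test_functions.
Context d (T : measurableType d) (R : realType).
Variable mu : {measure set T -> \bar R}.

(** By eq_integral_weighted applied to the positive and negative parts of W,
   against the positive part of V and then against its negative part. *)
Lemma Rintegral_test_eq0 (W V : T -> R) :
  measurable_fun [set: T] V ->
  mu.-integrable setT (EFin \o W) ->
  mu.-integrable setT (EFin \o (W \* V)) ->
  (forall B : set R, measurable B -> \int[mu]_(w in V @^-1` B) W w = 0) ->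
  \int[mu]_w (W w * V w) = 0.
Proof.
move=> mV iW iWV WB.
have mVB B : measurable B -> measurable (V @^-1` B).
  by move=> mB; rewrite -[X in measurable X]setTI; exact: mV.
have mW : measurable_fun setT W by apply/measurable_EFinP;
  exact: measurable_int iW.
have iWp := integrable_funrpos measurableT iW.
have iWn := integrable_funrneg measurableT iW.
have mWp : measurable_fun setT W^\+ by exact: measurable_funrpos.
have mWn : measurable_fun setT W^\- by exact: measurable_funrneg.
have W12 B : measurable B ->
  (\int[mu]_(w in V @^-1` B) (W^\+ w)%:E =
   \int[mu]_(w in V @^-1` B) (W^\- w)%:E)%E.
  move=> mB.
  have iWpB : mu.-integrable (V @^-1` B) (EFin \o W^\+).
    by apply: integrableS iWp => //; exact: mVB.
  have iWnB : mu.-integrable (V @^-1` B) (EFin \o W^\-).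
    by apply: integrableS iWn => //; exact: mVB.
  have : \int[mu]_(w in V @^-1` B) (W^\+ w - W^\- w) = 0.
    rewrite -(WB _ mB); apply: eq_Rintegral => w _.
    by rewrite -[in RHS](funrposBneg W).
  rewrite RintegralB//; last exact: mVB.
  move/eqP; rewrite subr_eq0 => /eqP H.
  rewrite -[LHS]fineK; last by apply: integrable_fin_num => //; exact: mVB.
  rewrite -[RHS]fineK; last by apply: integrable_fin_num => //; exact: mVB.
  by congr EFin; exact: H.
have key (f : R -> R) : (forall y, 0 <= f y) -> measurable_fun setT f ->
    (forall y, `|f y| <= `|y|) -> \int[mu]_w (W w * f (V w)) = 0.
  move=> f0 mf fle.
  have mfV : measurable_fun setT (f \o V) by exact: measurableT_comp.
  have ip (U : T -> R) : measurable_fun setT U ->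
      (forall w, `|U w| <= `|W w|) ->
      mu.-integrable setT (EFin \o (fun w => U w * f (V w))).
    move=> mU UW; apply: (le_integrable _ _ _ iWV) => //.
      by apply/measurable_EFinP; exact: measurable_funM.
    move=> w _ /=; rewrite lee_fin !normrM ler_pM//.
  have E1 : \int[mu]_w (W^\+ w * f (V w)) = \int[mu]_w (W^\- w * f (V w)).
    congr fine; under eq_integral do rewrite EFinM.
    under [RHS]eq_integral do rewrite EFinM.
    apply: (@eq_integral_weighted _ _ _ _ _ mu V mV _ _ mWp mWn
      _ _ W12 (EFin \o f)) => //.
    exact/measurable_EFinP.
  transitivity (\int[mu]_w (W^\+ w * f (V w) - W^\- w * f (V w))).
    by apply: eq_Rintegral => w _; rewrite -mulrBl -[in LHS](funrposBneg W).
  rewrite RintegralB//; first by rewrite E1 subrr.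
  - apply: ip => // w; rewrite ger0_norm//.
    by rewrite /funrpos ge_max normr_ge0 ler_norm.
  - apply: ip => // w; rewrite ger0_norm//.
    by rewrite /funrneg ge_max normr_ge0 -normrN ler_norm.
have mid : measurable_fun [set: R] (@idfun R) by exact: measurable_id.
transitivity (\int[mu]_w (W w * (idfun^\+ (V w)) - W w * (idfun^\- (V w)))).
  apply: eq_Rintegral => w _; rewrite -mulrBr; congr (_ * _).
  exact: (congr1 (fun g => g (V w)) (esym (funrposBneg (@idfun R)))).
have le_pos y : `|idfun^\+ y| <= `|y| :> R.
  by rewrite ger0_norm// /funrpos ge_max normr_ge0 ler_norm.
have le_neg y : `|idfun^\- y| <= `|y| :> R.
  by rewrite ger0_norm// /funrneg ge_max normr_ge0 -normrN ler_norm.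
have iWf (f : R -> R) : measurable_fun setT f -> (forall y, `|f y| <= `|y|) ->
    mu.-integrable setT (EFin \o (fun w => W w * f (V w))).
  move=> mf fle; apply: (le_integrable _ _ _ iWV) => //.
    by apply/measurable_EFinP; apply: measurable_funM => //;
      exact: measurableT_comp.
  by move=> w _ /=; rewrite lee_fin !normrM ler_wpM2l.
rewrite RintegralB//.
- rewrite !key ?subrr//;
    by [exact: measurable_funrneg|exact: measurable_funrpos].
- by apply: iWf => //; exact: measurable_funrpos.
- by apply: iWf => //; exact: measurable_funrneg.
Qed.

End test_functions.

(** * The Markov property for integrable functions *)

Section generated_sigma_algebras.
Context d (T : measurableType d) (R : realType).
Variables (P : probability T R) (X : int -> {RV P >-> R}).

Lemma measurable_RV_preimage n (B : set R) :
  measurable B -> measurable (X n @^-1` B).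
Proof.
by move=> mB; rewrite -[X in measurable X]setTI; exact: measurable_funP.
Qed.

Lemma gen_sigma_preimage (J : set int) j (B : set R) :
  J j -> measurable B -> gen_sigma X J (X j @^-1` B).
Proof.
move=> Jj mB; apply: sub_sigma_algebra; exists j => //.
by exists B => //; rewrite setTI.
Qed.

Lemma gen_sigma_measurable (J : set int) A : gen_sigma X J A -> measurable A.
Proof.
move: A; apply: smallest_sub; first exact: sigma_algebra_measurable.
by move=> A [j _] [B mB <-]; apply: measurableI => //;
  exact: measurable_RV_preimage.
Qed.

Lemma gen_sigmaS (J K : set int) : J `<=` K -> gen_sigma X J `<=` gen_sigma X K.
Proof.
move=> JK; apply: sub_smallest2r; first exact: smallest_sigma_algebra.
exact: bigcup_subset.
Qed.

Lemma gen_sigmaI (J : set int) A B :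
  gen_sigma X J A -> gen_sigma X J B -> gen_sigma X J (A `&` B).
Proof.
exact: (@measurableI _ (g_sigma_algebraType
          (\bigcup_(j in J) g_sigma_algebra_preimage (X j)))).
Qed.

Lemma gen_sigmaT (J : set int) : gen_sigma X J [set: T].
Proof.
exact: (@measurableT _ (g_sigma_algebraType
          (\bigcup_(j in J) g_sigma_algebra_preimage (X j)))).
Qed.

End generated_sigma_algebras.

Section markov.
Context d (T : measurableType d) (R : realType).
Variables (P : probability T R) (X : int -> {RV P >-> R}).
Hypothesis X_markov : homogeneous_markov_chain X.

(** The function g is the integral of f against the transition kernel; it may
   be infinite on a null set of states, where its finite part is taken. *)
Lemma markov_step_ge0 (f : R -> R) :
  measurable_fun [set: R] f -> (forall y, 0 <= f y) ->
  (forall n, P.-integrable setT (EFin \o (f \o X n))) ->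
  exists g : R -> R, [/\ measurable_fun [set: R] g,
    forall n, P.-integrable setT (EFin \o (g \o X n)) &
    forall n A, gen_sigma X [set j | j <= n] A ->
      \int[P]_(w in A) f (X (n + 1) w) = \int[P]_(w in A) g (X n w)].
Proof.
move=> mf f0 intf; have [kappa hk] := X_markov.
pose g0 y := (\int[kappa y]_z (f z)%:E)%E.
have mEf : measurable_fun [set: R] (EFin \o f) by exact/measurable_EFinP.
have g00 y : (0 <= g0 y)%E by apply: integral_ge0 => z _; rewrite lee_fin.
have kfin y U : measurable U -> kappa y U \is a fin_num.
  move=> mU; rewrite ge0_fin_numE//; apply: le_lt_trans (ltry 1).
  by rewrite -(prob_kernel y (s := kappa)); apply: le_measure; rewrite ?inE.
have mg0 : measurable_fun [set: R] g0.
  apply: measurable_fun_integral_kernel => //.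
  by move=> U mU; exact: measurable_kernel.
have mg0X n : measurable_fun [set: T] (g0 \o X n) by exact: measurableT_comp.
have g0E n A : gen_sigma X [set j | j <= n] A ->
    (\int[P]_(w in A) (f (X (n + 1) w))%:E = \int[P]_(w in A) g0 (X n w))%E.
  move=> GA; have mA := gen_sigma_measurable GA.
  transitivity (\int[P]_(w in A) \int[\d_(X (n + 1) w)]_z (f z)%:E)%E.
    by apply: eq_integral => w _; rewrite integral_dirac// diracT mul1e.
  apply: (eq_integral_mixture _ _ mA _ (f := EFin \o f)) => //.
  - move=> U mU; apply: (measurableT_comp (f := fun x : R => \d_x U)) => //.
    exact: measurable_fun_dirac.
  - move=> U mU; apply: (measurableT_comp (f := fun x => kappa x U)) => //.
    exact: measurable_kernel.
  - move=> U mU; have [_ _ _ /(_ A GA) hA] := hk n U mU.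
    transitivity (\int[P]_(w in A) (fine (kappa (X n w) U))%:E)%E.
      by rewrite hA; apply: eq_integral => w _; rewrite /= diracE indicE.
    by apply: eq_integral => w _; apply: fineK; exact: kfin.
have ig0 n : P.-integrable setT (g0 \o X n).
  apply/integrableP; split => //.
  rewrite (eq_integral (fun w => g0 (X n w))); last first.
    by move=> w _; rewrite /= gee0_abs.
  rewrite -(g0E n setT)//; last exact: gen_sigmaT.
  have /integrableP[_] := intf (n + 1).
  rewrite (eq_integral (fun w => (f (X (n + 1) w))%:E))//.
  by move=> w _; rewrite /= ger0_norm.
have mg : measurable_fun [set: R] (fine \o g0) by exact: measurableT_comp.
have ig n : P.-integrable setT (EFin \o ((fine \o g0) \o X n)).
  apply: (le_integrable _ _ _ (ig0 n)) => //.
    by apply/measurable_EFinP; exact: measurableT_comp.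
  by move=> w _ /=; case: (g0 (X n w)) => [r||] /=; rewrite ?leey.
exists (fine \o g0); split => // n A GA.
congr fine; rewrite g0E//.
have mA := gen_sigma_measurable GA.
apply: ae_eq_integral => //.
- by apply: measurable_funTS; exact: (mg0X n).
- by apply: measurable_funTS; exact: (measurable_int _ (ig n)).
- have := integrable_ae measurableT (ig0 n).
  by apply: filterS => w /(_ I) /= fin _; rewrite fineK.
Qed.

(** Split f into its positive and negative parts. The function g(X_n) is the
   conditional mean of f(X_(n+1)) given F_n. *)
Lemma markov_step (f : R -> R) :
  measurable_fun [set: R] f ->
  (forall n, P.-integrable setT (EFin \o (f \o X n))) ->
  exists g : R -> R, [/\ measurable_fun [set: R] g,
    forall n, P.-integrable setT (EFin \o (g \o X n)) &
    forall n A, gen_sigma X [set j | j <= n] A ->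
      \int[P]_(w in A) f (X (n + 1) w) = \int[P]_(w in A) g (X n w)].
Proof.
move=> mf intf.
have ifp n : P.-integrable setT (EFin \o (f^\+ \o X n)).
  exact: (@integrable_funrpos _ _ _ _ _ (f \o X n)).
have ifn n : P.-integrable setT (EFin \o (f^\- \o X n)).
  exact: (@integrable_funrneg _ _ _ _ _ (f \o X n)).
have [gp [mgp igp gpE]] :=
  markov_step_ge0 (measurable_funrpos mf) (@funrpos_ge0 _ _ f) ifp.
have [gn [mgn ign gnE]] :=
  markov_step_ge0 (measurable_funrneg mf) (@funrneg_ge0 _ _ f) ifn.
exists (gp \- gn); split.
- exact: measurable_funB.
- by move=> n; apply: eq_integrable (integrableB measurableT (igp n) (ign n)).
move=> n A GA; have mA := gen_sigma_measurable GA.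
have iA (h : T -> R) : P.-integrable setT (EFin \o h) ->
    P.-integrable A (EFin \o h).
  by apply: integrableS.
transitivity (\int[P]_(w in A) (f^\+ (X (n + 1) w) - f^\- (X (n + 1) w))).
  apply: eq_Rintegral => w _.
  exact: (congr1 (fun g => g (X (n + 1) w)) (esym (funrposBneg f))).
rewrite RintegralB//; [|exact: iA (ifp _)|exact: iA (ifn _)].
by rewrite gpE// gnE// -RintegralB//; [exact: iA (igp _)|exact: iA (ign _)].
Qed.

End markov.

(** * The recurrence satisfied by the means *)

(** The roots of a (1 + x^2) = x are rho and 1 / rho, so v_k = u_(k+1) - rho u_k
   is a multiple of rho^-k, and boundedness forces v = 0. *)
Lemma bounded_recurrence_geometric (R : realType) (a rho M : R) (u : nat -> R) :
  a * (1 + rho ^+ 2) = rho -> a != 0 -> `|rho| < 1 ->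
  (forall k, `|u k| <= M) ->
  (forall k, u k.+1 = a * (u k + u k.+2)) -> u 1%N = rho * u 0%N.
Proof.
move=> arho a0 rho1 uM uS; pose v k := u k.+1 - rho * u k.
have vS k : v k = rho * v k.+1.
  apply: (mulfI a0); rewrite /v; have := uS k; move: (u k) (u k.+1) (u k.+2).
  move=> x y z /eqP; rewrite -subr_eq0 => /eqP yE.
  move/eqP: arho; rewrite -subr_eq0 => /eqP arhoE.
  apply/eqP; rewrite -subr_eq0; apply/eqP.
  transitivity (y * (a * (1 + rho ^+ 2) - rho) + rho * (y - a * (x + z))).
    by ring.
  by rewrite arhoE yE !mulr0 addr0.
have v0 k : v 0%N = rho ^+ k * v k.
  elim: k => [|k ->]; first by rewrite expr0 mul1r.
  by rewrite vS exprSr mulrA.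
suff /normr0_eq0/eqP : `|v 0%N| = 0 by rewrite subr_eq0 => /eqP.
have vM k : `|v k| <= M + M.
  rewrite (le_trans (ler_normB _ _))// lerD// normrM.
  by rewrite (le_trans _ (uM k))// ler_piMl// ltW.
apply/eqP; rewrite eq_le normr_ge0 andbT.
have cvg0 : (fun k => `|rho| ^+ k * (M + M)) @ \oo --> (0 : R).
  rewrite -(mul0r (M + M)); apply: cvgM; last exact: cvg_cst.
  by apply: cvg_expr; rewrite normr_id.
rewrite -(cvg_lim _ cvg0)//; apply: limr_ge; first exact: cvgP cvg0.
apply: nearW => k; rewrite (v0 k) normrM normrX ler_wpM2l// exprn_ge0//.
Qed.

Lemma geometric_root (R : realType) (a : R) : a != 0 -> 2 * `|a| < 1 ->
  exists rho : R, a * (1 + rho ^+ 2) = rho /\ `|rho| < 1.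
Proof.
move=> a0 a1; pose s := Num.sqrt (1 - 4 * a ^+ 2).
have s0 : 0 <= s by exact: sqrtr_ge0.
have s2 : s ^+ 2 = 1 - 4 * a ^+ 2.
  rewrite sqr_sqrtr// -(real_normK (num_real a)).
  rewrite (_ : _ - _ = (1 - 2 * `|a|) * (1 + 2 * `|a|)); last by ring.
  have a_ge0 := normr_ge0 a; rewrite mulr_ge0//; lra.
have s1 : 1 + s != 0 by apply: lt0r_neq0; lra.
(* the smaller root (1 - s) / (2 a), rationalised *)
exists (2 * a / (1 + s)); have a_ge0 := normr_ge0 a; split.
- apply: (mulIf (expf_neq0 2 s1)).
  transitivity (a * ((1 + s) ^+ 2 + 4 * a ^+ 2)); first by field.
  rewrite (_ : 4 * a ^+ 2 = 1 - s ^+ 2); last by rewrite s2; ring.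
  by field.
- rewrite normrM normfV normrM normr_nat (@ger0_norm _ (1 + s)); last by lra.
  by rewrite ltr_pdivrMr; lra.
Qed.

(** * Integrable random variables and events of the chain *)

Section linear_combinations.
Context d (T : measurableType d) (R : realType) (P : probability T R).
Local Notation intg f := (P.-integrable [set: T] (EFin \o f)).
Implicit Types (A : set T) (f g : T -> R).

Lemma intgS A f : measurable A -> intg f -> P.-integrable A (EFin \o f).
Proof. by move=> mA; apply: integrableS. Qed.

Lemma intgD f g : intg f -> intg g -> intg (fun w => f w + g w).
Proof.
move=> fi gi.
exact: (integrableD measurableT fi gi).
Qed.

Lemma intgB f g : intg f -> intg g -> intg (fun w => f w - g w).
Proof.
move=> fi gi.
exact: (integrableB measurableT fi gi).
Qed.

Lemma intgZ c f : intg f -> intg (fun w => c * f w).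
Proof.
move=> fi.
exact: (integrableZl measurableT c fi).
Qed.

Lemma intg_cst c : intg (fun=> c).
Proof. exact: finite_measure_integrable_cst. Qed.

Lemma RintD A f g : measurable A -> intg f -> intg g ->
  \int[P]_(w in A) (f w + g w) = \int[P]_(w in A) f w + \int[P]_(w in A) g w.
Proof. by move=> mA fi gi; rewrite RintegralD//; exact: intgS. Qed.

Lemma RintB A f g : measurable A -> intg f -> intg g ->
  \int[P]_(w in A) (f w - g w) = \int[P]_(w in A) f w - \int[P]_(w in A) g w.
Proof. by move=> mA fi gi; rewrite RintegralB//; exact: intgS. Qed.

Lemma RintZ A c f : measurable A -> intg f ->
  \int[P]_(w in A) (c * f w) = c * \int[P]_(w in A) f w.
Proof. by move=> mA fi; rewrite RintegralZl//; exact: intgS. Qed.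

Lemma RintZD A c f g : measurable A -> intg f -> intg g ->
  \int[P]_(w in A) (c * f w + g w) =
  c * \int[P]_(w in A) f w + \int[P]_(w in A) g w.
Proof. by move=> mA fi gi; rewrite RintD ?RintZ//; exact: intgZ. Qed.

End linear_combinations.

Section square_integrable_chain.
Context d (T : measurableType d) (R : realType).
Variables (P : probability T R) (X : int -> {RV P >-> R}).
Local Notation intg f := (P.-integrable [set: T] (EFin \o f)).
Implicit Types (n k : int) (A : set T) (J : set int).

(** Orthogonality to the events of a sigma-algebra extends to its generating
   variables: apply Rintegral_test_eq0 to W restricted to A. *)
Lemma Rintegral_gen_sigma_test J j (W : T -> R) : J j ->
  intg W -> intg (fun w => W w * X j w) ->
  (forall A, gen_sigma X J A -> \int[P]_(w in A) W w = 0) ->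
  forall A, gen_sigma X J A -> \int[P]_(w in A) (W w * X j w) = 0.
Proof.
move=> Jj iW iWX W0 A GA; have mA := gen_sigma_measurable GA.
have restr (f : T -> R) : intg f -> intg (f \_ A).
  move=> fi; rewrite -restrict_EFin.
  by apply/(integrable_mkcond _ mA); exact: intgS.
transitivity (\int[P]_w ((W \_ A) w * X j w)).
  rewrite Rintegral_mkcond; apply: eq_Rintegral => w _.
  by rewrite !patchE; case: ifP => //; rewrite mul0r.
apply: Rintegral_test_eq0 => //.
- exact: restr.
- have -> : (W \_ A) \* X j = (fun w => W w * X j w) \_ A.
    by apply/funext => w /=; rewrite !patchE; case: ifP => //; rewrite mul0r.
  exact: restr.
- move=> B mB; rewrite -Rintegral_mkcondr W0//.
  by apply: gen_sigmaI => //; exact: gen_sigma_preimage.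
Qed.

(** Pushed forward to the law of X_n, the events of X_n become all the measurable
   sets of the line. *)
Lemma ae_eq0_of_Rintegral n (h : R -> R) : measurable_fun [set: R] h ->
  intg (h \o X n) ->
  (forall B : set R, measurable B ->
     \int[P]_(w in X n @^-1` B) h (X n w) = 0) ->
  {ae P, forall w, h (X n w) = 0}.
Proof.
move=> mh ih h0.
have mX : measurable_fun [set: T] (X n) by [].
have mEh : measurable_fun [set: R] (EFin \o h) by exact/measurable_EFinP.
have ilaw D : measurable D -> (distribution P (X n)).-integrable D (EFin \o h).
  move=> mD; apply: (integrable_pushforward mX) => //.
  by apply: (integrableS measurableT) ih => //; exact: measurable_RV_preimage.
have : ae_eq (distribution P (X n)) setT (EFin \o h) (cst 0%E).
  apply: integral_ae_eq => //; first exact: ilaw.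
  move=> E _ mE; have mXE := measurable_RV_preimage X n mE.
  have ihE : P.-integrable (X n @^-1` E) (EFin \o (h \o X n)).
    by apply: integrableS ih.
  rewrite integral0 (integral_pushforward mX)//.
  rewrite -[LHS]fineK; first by congr EFin; exact: h0.
  exact: integrable_fin_num.
move=> [N [mN N0 hN]]; exists (X n @^-1` N); split.
- exact: measurable_RV_preimage.
- exact: N0.
- by move=> w /= hw; apply: hN => /= H; apply: hw; have /eqP := H I;
    rewrite eqe => /eqP.
Qed.

Lemma Rintegral_ae_eq0 A (f : T -> R) : measurable A ->
  measurable_fun [set: T] f -> {ae P, forall w, f w = 0} ->
  \int[P]_(w in A) f w = 0.
Proof.
move=> mA mf f0; rewrite /Rintegral (ae_eq_integral (cst 0%E))//.
- by rewrite integral0.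
- by apply: measurable_funTS; exact/measurable_EFinP.
- by apply: filterS f0 => w + _; move=> /= ->.
Qed.

Hypothesis X_L2 : forall k : int, (X k : T -> R) \in Lfun P 2%:E.

Lemma intg_mulX n k : intg (fun w => X n w * X k w).
Proof. exact/Lfun1_integrable/Lfun2_mul_Lfun1. Qed.

Lemma intg_sqrX n : intg (fun w => X n w ^+ 2).
Proof. exact: Lfun2_integrable_sqr. Qed.

Lemma intgX n : intg (X n).
Proof.
apply/Lfun1_integrable; apply: Lfun_subset12 => //.
exact: fin_num_measure.
Qed.

End square_integrable_chain.

(** * Linear regression *)

Section linear_regression.
Context d (T : measurableType d) (R : realType).
Variables (P : probability T R) (X : int -> {RV P >-> R}).
Local Notation intg f := (P.-integrable [set: T] (EFin \o f)).
Implicit Types (n k : int) (A : set T) (J : set int).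
Hypothesis X_markov : homogeneous_markov_chain X.
Hypothesis X_L2 : forall k : int, (X k : T -> R) \in Lfun P 2%:E.
Hypothesis X_mean : forall k, \int[P]_w X k w = 0.
Hypothesis X_var : forall k, \int[P]_w X k w ^+ 2 = 1.

Let iX := intgX X_L2.
Let iXX := intg_mulX X_L2.
Let iX2 := intg_sqrX X_L2.

Lemma corrE k : corr X k = \int[P]_w (X 0 w * X k w).
Proof. by rewrite /corr unlock. Qed.

Lemma regression_Rintegral m (f : R -> R -> R) : two_sided_regression X m f ->
  forall n A, gen_sigma X [set n; n + 2] A ->
  \int[P]_(w in A) X (n + 1) w ^+ m = \int[P]_(w in A) f (X n w) (X (n + 2) w).
Proof.
move=> reg n A; have [_ _ _] := reg (n + 1).
rewrite addrK -addrA => H /H HA; congr fine; rewrite -HA.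
by [].
Qed.

Variables a b : R.
Hypothesis X_lin : two_sided_regression X 1 (sym_lin a b).

Lemma linear_regression_offset : b = 0.
Proof.
have /(regression_Rintegral X_lin) : gen_sigma X [set 0; 0 + 2] [set: T].
  exact: gen_sigmaT.
under eq_Rintegral do rewrite expr1.
rewrite X_mean /sym_lin RintD//; last 2 first.
- by apply: intgZ; apply: intgD.
- exact: intg_cst.
rewrite RintZ//; last exact: intgD.
rewrite RintD// !X_mean addr0 mulr0 add0r Rintegral_cst//.
rewrite (_ : fine _ = 1) ?mulr1; first by move=> <-.
exact: (congr1 fine (probability_setT P)).
Qed.

Lemma linear_regression n A : gen_sigma X [set n; n + 2] A ->
  \int[P]_(w in A) X (n + 1) w =
  a * (\int[P]_(w in A) X n w + \int[P]_(w in A) X (n + 2) w).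
Proof.
move=> GA; have mA := gen_sigma_measurable GA.
have := regression_Rintegral X_lin GA.
under eq_Rintegral do rewrite expr1.
move=> ->; rewrite /sym_lin linear_regression_offset.
under eq_Rintegral do rewrite addr0.
by rewrite RintZ//; [rewrite RintD|exact: intgD].
Qed.

Lemma linear_regression_test n A j : gen_sigma X [set n; n + 2] A ->
  j = n \/ j = n + 2 ->
  \int[P]_(w in A) (X (n + 1) w * X j w) =
  a * (\int[P]_(w in A) (X n w * X j w) +
       \int[P]_(w in A) (X (n + 2) w * X j w)).
Proof.
move=> GA Jj; have mA := gen_sigma_measurable GA.
pose W w := X (n + 1) w - a * (X n w + X (n + 2) w).
have WX w : W w * X j w = X (n + 1) w * X j w -
    a * (X n w * X j w + X (n + 2) w * X j w) by rewrite /W; ring.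
have iXD : intg (fun w => X n w * X j w + X (n + 2) w * X j w) by exact: intgD.
have iW : intg W by apply: intgB => //; apply: intgZ; exact: intgD.
have : \int[P]_(w in A) (W w * X j w) = 0.
  apply: (@Rintegral_gen_sigma_test _ _ _ _ X [set n; n + 2]) => //.
  - apply: (eq_integrable _ (EFin \o (fun w => X (n + 1) w * X j w -
      a * (X n w * X j w + X (n + 2) w * X j w)))) => //.
    + by move=> w _ /=; rewrite WX.
    + by apply: intgB => //; exact: intgZ.
  - move=> B GB; have mB := gen_sigma_measurable GB.
    rewrite /W RintB//; last by apply: intgZ; exact: intgD.
    by rewrite RintZ//;
      [rewrite RintD// -linear_regression// subrr|exact: intgD].
under eq_Rintegral do rewrite WX.
rewrite RintB//; last exact: intgZ.
by rewrite RintZ// RintD// => /eqP; rewrite subr_eq0 => /eqP.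
Qed.

(** The linear regression tested against X_0. *)
Lemma corr1E : corr X 1 = a * (1 + corr X 2).
Proof.
have GT : gen_sigma X [set 0; 0 + 2] [set: T] by exact: gen_sigmaT.
have := linear_regression_test GT (or_introl erefl).
rewrite !corrE !add0r.
under eq_Rintegral do rewrite mulrC.
move=> ->; congr (_ * (_ + _)); first by rewrite -(X_var 0).
by apply: eq_Rintegral => w _; rewrite mulrC.
Qed.

(** Given X_n, the next two states are independent of the past, so an identity
   between conditional means given X_n holds given the whole past. Concretely
   X_(n+1) and X_(n+2) have conditional means g(X_n) and h(X_n) given F_n; the
   regression tested on events of X_n gives g(x) = a (x + h(x)) almost surely. *)
Lemma linear_regression_past n A : gen_sigma X [set j | j <= n] A ->
  \int[P]_(w in A) X (n + 1) w =
  a * (\int[P]_(w in A) X n w + \int[P]_(w in A) X (n + 2) w).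
Proof.
have [g [mg ig gE]] := markov_step X_markov (@measurable_id _ R setT) iX.
have [h [mh ih hE]] := markov_step X_markov mg ig.
have X2E B : gen_sigma X [set j | j <= n] B ->
    \int[P]_(w in B) X (n + 2) w = \int[P]_(w in B) h (X n w).
  move=> GB; rewrite -hE// -gE//; first by rewrite -addrA.
  apply: gen_sigmaS GB => j /= jn; rewrite (le_trans jn)// lerDl//.
pose D x := g x - a * (x + h x).
have iXh : intg (fun w => X n w + h (X n w)) by apply: intgD => //; exact: ih.
have iD : intg (D \o X n).
  by apply: intgB; [exact: ig|exact: intgZ].
have DE B : gen_sigma X [set j | j <= n] B -> \int[P]_(w in B) D (X n w) =
    \int[P]_(w in B) X (n + 1) w -
    a * (\int[P]_(w in B) X n w + \int[P]_(w in B) X (n + 2) w).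
  move=> GB; have mB := gen_sigma_measurable GB.
  rewrite RintB//; [|exact: ig|exact: intgZ].
  rewrite RintZ// RintD//; last exact: ih.
  by rewrite X2E// gE.
have mD : measurable_fun [set: R] D.
  by apply: measurable_funB => //; apply: measurable_funM => //;
    exact: measurable_funD.
have D0 : {ae P, forall w, D (X n w) = 0}.
  apply: ae_eq0_of_Rintegral => // B mB.
  rewrite DE; last by apply: gen_sigma_preimage => //=; exact: lexx.
  rewrite linear_regression ?subrr//; apply: gen_sigma_preimage => //.
  by left.
move=> GA; have mA := gen_sigma_measurable GA.
apply/eqP; rewrite -subr_eq0 -DE//; apply/eqP; apply: Rintegral_ae_eq0 => //.
exact: measurableT_comp.
Qed.

End linear_regression.

(** * From the two-sided to the one-sided linear regression *)

Section quadratic_regression.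
Context d (T : measurableType d) (R : realType).
Variables (P : probability T R) (X : int -> {RV P >-> R}).
Local Notation intg f := (P.-integrable [set: T] (EFin \o f)).
Implicit Types (n k : int) (A : set T) (J : set int).
Hypothesis X_markov : homogeneous_markov_chain X.
Hypothesis X_L2 : forall k : int, (X k : T -> R) \in Lfun P 2%:E.
Hypothesis X_mean : forall k, \int[P]_w X k w = 0.
Hypothesis X_var : forall k, \int[P]_w X k w ^+ 2 = 1.
Let iX := intgX X_L2.
Let iXX := intg_mulX X_L2.
Let iX2 := intg_sqrX X_L2.

(** A conditional mean p(X_n) given X_n is the conditional mean given F_n,
   because it agrees almost surely with the g(X_n) of markov_step. *)
Lemma markov_upgrade n (f p : R -> R) :
  measurable_fun [set: R] f -> (forall k, intg (f \o X k)) ->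
  measurable_fun [set: R] p -> intg (p \o X n) ->
  (forall B, measurable B -> \int[P]_(w in X n @^-1` B) f (X (n + 1) w) =
                             \int[P]_(w in X n @^-1` B) p (X n w)) ->
  forall A, gen_sigma X [set j | j <= n] A ->
    \int[P]_(w in A) f (X (n + 1) w) = \int[P]_(w in A) p (X n w).
Proof.
move=> mf If mp ip fp A GA; have mA := gen_sigma_measurable GA.
have [g [mg ig gE]] := markov_step X_markov mf If.
have gp0 : {ae P, forall w, (g \- p) (X n w) = 0}.
  apply: ae_eq0_of_Rintegral => //.
  - exact: measurable_funB.
  - by apply: intgB => //; exact: ig.
  - move=> B mB; have mXB := measurable_RV_preimage X n mB.
    rewrite RintB//; last exact: ig.
    rewrite -gE ?fp ?subrr//.
    by apply: gen_sigma_preimage => //=; exact: lexx.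
rewrite gE//; apply/eqP; rewrite -subr_eq0 -RintB//; last exact: ig.
apply/eqP; apply: (Rintegral_ae_eq0 mA) gp0.
by apply: measurableT_comp => //; exact: measurable_funB.
Qed.

Variables a b : R.
Hypothesis X_lin : two_sided_regression X 1 (sym_lin a b).
Hypothesis r_neq0 : corr X 1 != 0.
Hypothesis r_lt : 2 * `|corr X 1| < 1 + corr X 2.

Local Notation r := (corr X 1).

Lemma linear_coefficient_small : a != 0 /\ 2 * `|a| < 1.
Proof.
have rE := corr1E X_L2 X_mean X_var X_lin.
have c2 : 0 < 1 + corr X 2.
  by apply: le_lt_trans r_lt; rewrite mulr_ge0.
split; first by apply: contraNneq r_neq0 => a0; rewrite rE a0 mul0r.
move: r_lt; rewrite {1}rE normrM (gtr0_norm c2) mulrA.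
by rewrite -[ltRHS]mul1r ltr_pM2r.
Qed.

(** From |x| <= 1 + x^2; what matters is that the bound is uniform in n. *)
Lemma norm_RintegralX_le n A : measurable A -> `|\int[P]_(w in A) X n w| <= 2.
Proof.
move=> mA; apply: le_trans (le_normr_Rintegral mA (intgS mA (iX n))) _.
have iN : intg (fun w => `|X n w|) by exact: integrable_norm.
apply: (@le_trans _ _ (\int[P]_w `|X n w|)).
  rewrite Rintegral_mkcond; apply: le_Rintegral => //.
    rewrite -restrict_EFin; apply/(integrable_mkcond _ mA); exact: intgS.
  by move=> w _; rewrite patchE; case: ifP => _; [exact: lexx|exact: normr_ge0].
apply: (@le_trans _ _ (\int[P]_w (1 + X n w ^+ 2))).
  apply: le_Rintegral => //; first by apply: intgD => //; exact: intg_cst.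
  by move=> w _; rewrite -(real_normK (num_real (X n w)));
    have := normr_ge0 (X n w); nra.
rewrite RintD//; last exact: intg_cst.
rewrite X_var Rintegral_cst// (_ : fine _ = 1); first by lra.
exact: (congr1 fine (probability_setT P)).
Qed.

(** The means of X_(n+k) over A solve the bounded recurrence. *)
Lemma regression_on_past rho n A : a * (1 + rho ^+ 2) = rho -> `|rho| < 1 ->
  gen_sigma X [set j | j <= n] A ->
  \int[P]_(w in A) X (n + 1) w = rho * \int[P]_(w in A) X n w.
Proof.
move=> arho rho1 GA; have mA := gen_sigma_measurable GA.
pose u (k : nat) := \int[P]_(w in A) X (n + k%:Z) w.
have [a0 _] := linear_coefficient_small.
have := @bounded_recurrence_geometric _ a rho 2 u arho a0 rho1.
rewrite /u addr0; apply => k; first exact: norm_RintegralX_le.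
have -> : n + k.+2%:Z = n + k%:Z + 2 by rewrite -addrA -PoszD addn2.
have -> : n + k.+1%:Z = n + k%:Z + 1 by rewrite -addrA -PoszD addn1.
apply: (linear_regression_past X_markov X_L2 X_mean X_lin).
by apply: gen_sigmaS GA => j /= jn; rewrite (le_trans jn)// lerDl.
Qed.

Lemma regression_on_past_test rho n j A : a * (1 + rho ^+ 2) = rho ->
  `|rho| < 1 -> gen_sigma X [set j | j <= n] A -> j <= n ->
  \int[P]_(w in A) (X (n + 1) w * X j w) =
  rho * \int[P]_(w in A) (X n w * X j w).
Proof.
move=> arho rho1 GA jn; have mA := gen_sigma_measurable GA.
pose W w := X (n + 1) w - rho * X n w.
have WX : (fun w => W w * X j w) =
    (fun w => X (n + 1) w * X j w - rho * (X n w * X j w)).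
  by apply/funext => w; rewrite /W; ring.
have iW : intg W by apply: intgB => //; exact: intgZ.
have iWX : intg (fun w => W w * X j w).
  by rewrite WX; apply: intgB => //; exact: intgZ.
have : \int[P]_(w in A) (W w * X j w) = 0.
  apply: (Rintegral_gen_sigma_test (X := X) (J := [set j | j <= n])) => //.
  move=> B GB; have mB := gen_sigma_measurable GB.
  rewrite /W RintB//; last exact: intgZ.
  by rewrite RintZ// (regression_on_past arho)// subrr.
rewrite WX RintB//; last exact: intgZ.
by rewrite RintZ// => /eqP; rewrite subr_eq0 => /eqP.
Qed.

(** The small root of a (1 + x^2) = x is r itself: test regression_on_past
   against X_0. *)
Lemma corr1_root : a * (1 + r ^+ 2) = r /\ `|r| < 1.
Proof.
have [a0 a1] := linear_coefficient_small.
have [rho [arho rho1]] := geometric_root a0 a1.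
have GT : gen_sigma X [set j | j <= 0] [set: T] by exact: gen_sigmaT.
have := regression_on_past_test arho rho1 GT (lexx 0).
rewrite add0r (_ : \int[P]_w (X 0 w * X 0 w) = 1) ?mulr1; last first.
  by rewrite -(X_var 0).
under eq_Rintegral do rewrite mulrC.
by rewrite -corrE => ->.
Qed.

Let arE : a * (1 + r ^+ 2) = r. Proof. by case: corr1_root. Qed.
Let r_lt1 : `|r| < 1. Proof. by case: corr1_root. Qed.

(** * Second moments *)

Lemma past_preimage n B : measurable B ->
  gen_sigma X [set j | j <= n] (X n @^-1` B).
Proof. by move=> mB; apply: gen_sigma_preimage => //=; exact: lexx. Qed.

Lemma regression_X1 n B : measurable B ->
  \int[P]_(w in X n @^-1` B) X (n + 1) w = r * \int[P]_(w in X n @^-1` B) X n w.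
Proof. by move=> mB; apply: regression_on_past => //; exact: past_preimage. Qed.

Lemma past_preimageS n B : measurable B ->
  gen_sigma X [set j | j <= n + 1] (X n @^-1` B).
Proof. by move=> mB; apply: gen_sigma_preimage => //=; rewrite lerDl. Qed.

Lemma regression_X2 n B : measurable B ->
  \int[P]_(w in X n @^-1` B) X (n + 2) w =
  r ^+ 2 * \int[P]_(w in X n @^-1` B) X n w.
Proof.
move=> mB; rewrite (_ : n + 2 = n + 1 + 1) -?addrA//.
rewrite addrA (regression_on_past arE)//; last exact: past_preimageS.
by rewrite regression_X1// mulrA -expr2.
Qed.

Lemma regression_X0X2 n B : measurable B ->
  \int[P]_(w in X n @^-1` B) (X n w * X (n + 2) w) =
  r ^+ 2 * \int[P]_(w in X n @^-1` B) X n w ^+ 2.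
Proof.
move=> mB; under eq_Rintegral do rewrite mulrC.
rewrite (_ : n + 2 = n + 1 + 1) -?addrA//.
rewrite addrA (regression_on_past_test arE)//;
  [|exact: past_preimageS|by rewrite lerDl].
rewrite (regression_on_past_test arE)//; last exact: past_preimage.
by rewrite mulrA -expr2.
Qed.

(** The mean of X_(n+1) X_(n+2) over an event of X_n is r E(X_(n+1)^2 1_A) by the
   one-sided regression, and a E((X_n + X_(n+2)) X_(n+2) 1_A) by the two-sided
   one. *)
Lemma regression_second_moments n B : measurable B ->
  (1 + r ^+ 2) * \int[P]_(w in X n @^-1` B) X (n + 1) w ^+ 2 =
  r ^+ 2 * \int[P]_(w in X n @^-1` B) X n w ^+ 2 +
  \int[P]_(w in X n @^-1` B) X (n + 2) w ^+ 2.
Proof.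
move=> mB; set A := X n @^-1` B.
have GA : gen_sigma X [set n; n + 2] A by apply: gen_sigma_preimage => //; left.
have := linear_regression_test X_L2 X_mean X_lin GA (or_intror erefl).
rewrite (regression_X0X2 n mB).
under eq_Rintegral do rewrite mulrC.
rewrite (_ : n + 2 = n + 1 + 1) -?addrA//.
rewrite {1}addrA (regression_on_past_test arE)//; [|exact: past_preimageS].
move=> E; have [a0 _] := linear_coefficient_small.
by apply: (mulfI a0); rewrite mulrA arE; exact: E.
Qed.

Variables A B C D : R.
Hypothesis X_quad : two_sided_regression X 2 (sym_quad A B C D).

(** The quadratic regression conditioned on X_n, with the second moment of
   X_(n+2) eliminated by regression_second_moments. *)
Lemma regression_quadratic n U : measurable U ->
  (1 - A * (1 + r ^+ 2)) * \int[P]_(w in X n @^-1` U) X (n + 1) w ^+ 2 =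
  (A - A * r ^+ 2 + B * r ^+ 2) * \int[P]_(w in X n @^-1` U) X n w ^+ 2 +
  D * (1 + r ^+ 2) * \int[P]_(w in X n @^-1` U) X n w +
  C * \int[P]_(w in X n @^-1` U) 1.
Proof.
move=> mU; set E := X n @^-1` U.
have mE : measurable E by exact: measurable_RV_preimage.
have GE : gen_sigma X [set n; n + 2] E by apply: gen_sigma_preimage => //; left.
have := regression_Rintegral X_quad GE.
have -> : \int[P]_(w in E) sym_quad A B C D (X n w) (X (n + 2) w) =
  \int[P]_(w in E) (A * X n w ^+ 2 + (A * X (n + 2) w ^+ 2 +
     (B * (X n w * X (n + 2) w) + (D * X n w + (D * X (n + 2) w + C * 1))))).
  by apply: eq_Rintegral => w _; rewrite /sym_quad; ring.
have i1 : intg (fun w => C * 1) by apply: intgZ; exact: intg_cst.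
have i2 : intg (fun w => D * X (n + 2) w + C * 1) by apply: intgD => //;
  exact: intgZ.
have i3 : intg (fun w => D * X n w + (D * X (n + 2) w + C * 1)).
  by apply: intgD => //; exact: intgZ.
have i4 : intg (fun w => B * (X n w * X (n + 2) w) +
    (D * X n w + (D * X (n + 2) w + C * 1))).
  by apply: intgD => //; exact: intgZ.
have i5 : intg (fun w => A * X (n + 2) w ^+ 2 + (B * (X n w * X (n + 2) w) +
    (D * X n w + (D * X (n + 2) w + C * 1)))).
  by apply: intgD => //; exact: intgZ.
do 5![rewrite RintZD//].
rewrite RintZ//; last exact: intg_cst.
rewrite regression_X0X2// regression_X2//.
have := regression_second_moments n mU; rewrite -/E => E2 E1.
have {}E2 : \int[P]_(w in E) X (n + 2) w ^+ 2 =
   (1 + r ^+ 2) * \int[P]_(w in E) X (n + 1) w ^+ 2 -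
   r ^+ 2 * \int[P]_(w in E) X n w ^+ 2.
  by rewrite E2; ring.
move: E1; rewrite E2; move: (\int[P]_(w in E) X (n + 1) w ^+ 2) => q1 E1.
move/eqP : E1; rewrite -subr_eq0 => /eqP E1.
apply/eqP; rewrite -subr_eq0; apply/eqP; rewrite -[RHS]E1; ring.
Qed.

(** * The degenerate chain *)

Lemma Rintegral_poly n E al be ga : measurable E ->
  \int[P]_(w in E) (al * X n w ^+ 2 + (be * X n w + ga * 1)) =
  al * \int[P]_(w in E) X n w ^+ 2 + be * \int[P]_(w in E) X n w +
  ga * \int[P]_(w in E) 1.
Proof.
move=> mE; have i1 : intg (fun w => ga * 1) by apply: intgZ; exact: intg_cst.
have i2 : intg (fun w => be * X n w + ga * 1) by apply: intgD => //;
  exact: intgZ.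
rewrite !RintZD// RintZ ?addrA//; exact: intg_cst.
Qed.

Lemma intg_poly n al be ga :
  intg (fun w => al * X n w ^+ 2 + (be * X n w + ga * 1)).
Proof.
by apply: intgD; [exact: intgZ|apply: intgD; [exact: intgZ|apply: intgZ;
  exact: intg_cst]].
Qed.

Lemma measurable_poly (al be ga : R) :
  measurable_fun [set: R] (fun x : R => al * x ^+ 2 + (be * x + ga * 1)).
Proof.
apply: measurable_funD; first by apply: measurable_funM => //;
  exact: measurable_funX.
by apply: measurable_funD => //; exact: measurable_funM.
Qed.

(** Linear independence of 1, X_0, X_0^2 modulo null sets, in the form in which
   it is applied: on integrals over the events of X_0. *)
Definition moments_free := forall al be ga : R,
  (forall U : set R, measurable U ->
     al * \int[P]_(w in X 0 @^-1` U) X 0 w ^+ 2 +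
     be * \int[P]_(w in X 0 @^-1` U) X 0 w +
     ga * \int[P]_(w in X 0 @^-1` U) 1 = 0) ->
  [/\ al = 0, be = 0 & ga = 0].

Lemma first_moment_free be :
  (forall U : set R, measurable U ->
     be * \int[P]_(w in X 0 @^-1` U) X 0 w = 0) ->
  be = 0.
Proof.
move=> H; have iW : intg (fun w => be * X 0 w) by exact: intgZ.
have iWX : intg ((fun w => be * X 0 w) \* X 0).
  rewrite (_ : _ \* _ = fun w => be * (X 0 w * X 0 w)); first exact: intgZ.
  by apply/funext => w /=; rewrite mulrA.
have : \int[P]_w (be * X 0 w * X 0 w) = 0.
  apply: Rintegral_test_eq0 => // U mU; rewrite RintZ ?H//.
  exact: measurable_RV_preimage.
under eq_Rintegral do rewrite -mulrA.
by rewrite RintZ// (X_var 0) mulr1.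
Qed.

Hypothesis X_stat : strictly_stationary X.

(** Strict stationarity applied to one-dimensional marginals. *)
Lemma stationary_ae (f : R -> R) n : measurable_fun [set: R] f ->
  {ae P, forall w, f (X 0 w) = 0} -> {ae P, forall w, f (X n w) = 0}.
Proof.
move=> mf f0.
have mB : measurable [set t : 1.-tuple R | f (tnth t ord0) != 0].
  rewrite (_ : [set _ | _] = (f \o (fun t => tnth t ord0)) @^-1` (~` [set 0])).
    rewrite -[X in measurable X]setTI; apply: (measurableT_comp mf) => //.
      exact: measurable_tnth.
    exact: measurableC.
  by apply/seteqP; split => t /= /eqP.
have m0 k : measurable [set w | f (X k w) != 0].
  rewrite (_ : [set _ | _] = X k @^-1` (f @^-1` (~` [set 0]))).
    apply: measurable_RV_preimage; rewrite -[X in measurable X]setTI;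
      apply: mf => //.
    exact: measurableC.
  by apply/seteqP; split => t /= /eqP.
have setE k : [set w | [set t : 1.-tuple R | f (tnth t ord0) != 0]
    [tuple X k w | i < 1]] = [set w | f (X k w) != 0].
  by apply/funext => w /=; rewrite tnth_mktuple.
have Pf0 : P [set w | f (X 0 w) != 0] = 0%E.
  apply: measure_negligible => //; apply: (negligibleS _ f0).
  by move=> w /= /eqP.
have : P [set w | f (X n w) != 0] = 0%E.
  rewrite -Pf0 -!setE.
  have := X_stat [tuple 0] n mB.
  rewrite (_ : [set w | _ [tuple X (tnth [tuple 0] i + n) w | i < 1]] =
    [set w | [set t : 1.-tuple R | f (tnth t ord0) != 0]
      [tuple X n w | i < 1]]); last first.
    by apply/funext => w /=; rewrite !tnth_mktuple (tnth_nth 0)/= add0r.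
  move=> ->; congr (P _).
  by apply/funext => w /=; rewrite !tnth_mktuple (tnth_nth 0)/=.
move=> Pfn; exists [set w | f (X n w) != 0]; split => //.
by move=> w /= /eqP.
Qed.

(** A linear dependence makes X_n a root of x^2 = c x + 1, by stationarity for
   every n with the same c. Then second moments are affine in first moments, and
   regression_second_moments reduces to c r (1 - r)^2 X_0 = 0. *)
Lemma unit_square_or_moments_free :
  (forall n, {ae P, forall w, X n w ^+ 2 = 1}) \/ moments_free.
Proof.
have [free|nfree] := pselect moments_free; [by right|left].
move: nfree => /existsNP[al /existsNP[be /existsNP[ga /not_implyP[H nz]]]].
(* integrate over the whole space *)
have alga : al + ga = 0.
  have := H setT measurableT.
  rewrite preimage_setT X_var X_mean mulr1 mulr0 addr0 Rintegral_cst//.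
  rewrite (_ : fine _ = 1) ?mulr1//.
  exact: (congr1 fine (probability_setT P)).
have al0 : al != 0.
  apply/eqP => al0; apply: nz; have ga0 : ga = 0 by rewrite -alga al0 add0r.
  split => //; apply: first_moment_free => U mU.
  by rewrite -[RHS](H U mU) al0 ga0 !mul0r add0r addr0.
pose c := - (be / al).
have X2E n : {ae P, forall w, 1 * X n w ^+ 2 + (- c * X n w + (- 1) * 1) = 0}.
  pose h (x : R) := 1 * x ^+ 2 + (- c * x + (- 1) * 1).
  apply: (@stationary_ae h n (measurable_poly 1 (- c) (- 1))).
  apply: (@ae_eq0_of_Rintegral _ _ _ _ X 0 h);
    [exact: measurable_poly|exact: intg_poly|].
  move=> U mU; rewrite Rintegral_poly; last exact: measurable_RV_preimage.
  apply: (mulfI al0); rewrite mulr0 -[RHS](H U mU) /c opprK.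
  rewrite (_ : ga = - al); last by apply/eqP; rewrite -addr_eq0 addrC alga.
  by field.
have m2E n E : measurable E -> \int[P]_(w in E) X n w ^+ 2 =
    c * \int[P]_(w in E) X n w + \int[P]_(w in E) 1.
  move=> mE; have := Rintegral_poly n 1 (- c) (- 1) mE.
  rewrite (Rintegral_ae_eq0 mE _ (X2E n)); last first.
    by apply: (measurableT_comp (measurable_poly 1 (- c) (- 1))).
  lra.
have c0 : c = 0.
  have K0 : c * (r * (1 - r) ^+ 2) = 0.
    apply: first_moment_free => U mU.
    have mE := measurable_RV_preimage X 0 mU.
    have := regression_second_moments 0 mU.
    rewrite !m2E// regression_X1// regression_X2// => /eqP;
      rewrite -subr_eq0 => /eqP H0.
    by rewrite -[RHS]H0; ring.
  apply/eqP; move/eqP: K0; rewrite !mulf_eq0 (negbTE r_neq0) /= orbb subr_eq0.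
  case/orP => // /eqP r1; move: r_lt1; rewrite -r1 normr1 ltxx//.
move=> n; apply: filterS (X2E n) => w.
rewrite c0; lra.
Qed.

(** * The coefficients of the quadratic regression *)

(** Either the coefficient k of E(X_1^2 | X_0) vanishes, and so does the whole
   polynomial on the other side, or E(X_1^2 | X_0) is a quadratic polynomial in
   X_0. In the second case the Markov property makes E(X_2^2 | X_0) a quadratic
   polynomial in X_0 as well, and regression_second_moments becomes an identity
   between polynomials in X_0. *)
Lemma quadratic_coefficients : moments_free ->
  D = 0 /\ (A * (r ^+ 2 + 1 / r ^+ 2) + B = 1 \/ 2 * A + B * r ^+ 2 = 1).
Proof.
move=> free; pose k := 1 - A * (1 + r ^+ 2).
have D_eq0 : D * (1 + r ^+ 2) = 0 -> D = 0.
  move=> /eqP; rewrite mulf_eq0 => /orP[/eqP//|]; rewrite paddr_eq0 ?sqr_ge0//.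
  by rewrite oner_eq0.
have [k0|k0] := eqVneq k 0.
  have [|e1 /D_eq0 -> e3] :=
    free (A - A * r ^+ 2 + B * r ^+ 2) (D * (1 + r ^+ 2)) C.
    by move=> U mU; rewrite -(regression_quadratic 0 mU) -/k k0 mul0r.
  split => //; right; move: k0 e1; rewrite /k; lra.
pose al := (A - A * r ^+ 2 + B * r ^+ 2) / k.
pose be := D * (1 + r ^+ 2) / k.
pose ga := C / k.
have q1 n U : measurable U -> \int[P]_(w in X n @^-1` U) X (n + 1) w ^+ 2 =
    al * \int[P]_(w in X n @^-1` U) X n w ^+ 2 +
    be * \int[P]_(w in X n @^-1` U) X n w + ga * \int[P]_(w in X n @^-1` U) 1.
  move=> mU; apply: (mulfI k0); rewrite (regression_quadratic n mU).
  by rewrite /al /be /ga; field.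
have q2 U : measurable U -> \int[P]_(w in X 0 @^-1` U) X (0 + 2) w ^+ 2 =
    al * \int[P]_(w in X 0 @^-1` U) X (0 + 1) w ^+ 2 +
    be * (r * \int[P]_(w in X 0 @^-1` U) X 0 w) +
    ga * \int[P]_(w in X 0 @^-1` U) 1.
  move=> mU; rewrite -regression_X1// -Rintegral_poly;
    last exact: measurable_RV_preimage.
  rewrite (_ : 0 + 2 = 0 + 1 + 1)//.
  apply: (markov_upgrade (f := fun x => x ^+ 2)
    (p := fun x => al * x ^+ 2 + (be * x + ga * 1))) => //.
  - exact: measurable_poly.
  - exact: intg_poly.
  - move=> V mV; rewrite q1// Rintegral_poly//; exact: measurable_RV_preimage.
  - exact: past_preimageS.
have [|e1 e2 e3] := free ((1 + r ^+ 2 - al) * al - r ^+ 2)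
    ((1 + r ^+ 2 - al) * be - be * r) ((1 + r ^+ 2 - al) * ga - ga).
  move=> U mU; have := regression_second_moments 0 mU.
  rewrite q2// q1// => /eqP; rewrite -subr_eq0 => /eqP E.
  by rewrite -[RHS]E; ring.
have r1 : 1 - r != 0.
  by rewrite subr_eq0; apply: contraTneq r_lt1 => <-; rewrite normr1 ltxx.
have : (al - 1) * (al - r ^+ 2) = 0.
  by rewrite -[RHS]oppr0 -e1; ring.
have alE : A - A * r ^+ 2 + B * r ^+ 2 = al * k by rewrite /al; field.
have beE : D * (1 + r ^+ 2) = be * k by rewrite /be; field.
have r20 : r ^+ 2 != 0 by rewrite expf_eq0.
move/eqP; rewrite mulf_eq0 !subr_eq0 => /orP[/eqP al1|/eqP alr].
  split.
    apply: D_eq0; rewrite beE; suff -> : be = 0 by rewrite mul0r.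
    apply: (mulIf (mulf_neq0 r_neq0 r1)); rewrite mul0r -[RHS]oppr0 -e2 al1;
      ring.
  right; move: alE; rewrite al1 /k; lra.
split.
  apply: D_eq0; rewrite beE; suff -> : be = 0 by rewrite mul0r.
  by apply: (mulIf r1); rewrite mul0r -[RHS]e2 alr; ring.
left; apply: (mulfI r20).
transitivity (A * (r ^+ 4 + 1) + B * r ^+ 2); first by field.
move: alE; rewrite alr /k => alE.
transitivity (A - A * r ^+ 2 + B * r ^+ 2 + A * r ^+ 2 * (1 + r ^+ 2));
  first by ring.
by rewrite alE; ring.
Qed.

End quadratic_regression.

(** * Proof of the theorem *)

(** Both X_k^2 and (X_(k-1)^2 + X_(k+1)^2) / 2 are almost surely 1. *)
Lemma unit_square_regression d (T : measurableType d) (R : realType)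
    (P : probability T R) (X : int -> {RV P >-> R}) :
  (forall k, (X k : T -> R) \in Lfun P 2%:E) ->
  (forall k, {ae P, forall w, X k w ^+ 2 = 1}) ->
  two_sided_regression X 2 (sym_quad (1 / 2) 0 0 0).
Proof.
move=> X_L2 X1 k.
have iX2 := intg_sqrX X_L2.
have quadE : (fun w => sym_quad (1 / 2) 0 0 0 (X (k - 1) w) (X (k + 1) w)) =
    (fun w => 1 / 2 * (X (k - 1) w ^+ 2 + X (k + 1) w ^+ 2)).
  by apply/funext => w; rewrite /sym_quad !mul0r !addr0.
rewrite quadE.
have iZ : P.-integrable setT
    (EFin \o (fun w => 1 / 2 * (X (k - 1) w ^+ 2 + X (k + 1) w ^+ 2))).
  by apply: intgZ; exact: intgD.
split => //.
- move=> B mB.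
  pose G := \bigcup_(j in [set k - 1; k + 1]) g_sigma_algebra_preimage (X j).
  have mX j : [set k - 1; k + 1] j ->
      measurable_fun [set: g_sigma_algebraType G] (X j).
    by move=> Jj _ V mV; rewrite setTI; exact: gen_sigma_preimage.
  rewrite /gen_sigma -[X in <<s _ >> X]setTI.
  suff : measurable_fun [set: g_sigma_algebraType G]
    (fun w => 1 / 2 * (X (k - 1) w ^+ 2 + X (k + 1) w ^+ 2)) by apply.
  apply: measurable_funM => //; apply: measurable_funD.
  + by apply: measurable_funX; apply: mX; left.
  + by apply: measurable_funX; apply: mX; right.
- move=> A GA; have mA := gen_sigma_measurable GA.
  apply: ae_eq_integral => //.
  + by apply: measurable_funTS; exact: measurable_int iZ.
  + by apply: measurable_funTS; exact: (measurable_int _ (iX2 k)).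
  + apply: filterS3 (X1 (k - 1)) (X1 (k + 1)) (X1 k) => w e1 e2 e3 _.
    by rewrite e1 e2 e3; congr EFin; field.
Qed.

Theorem theorem2p1 (R : realType) (d : measure_display) (T : measurableType d)
    (P : probability T R) (X : int -> {RV P >-> R})
    (hstat : strictly_stationary X)
    (hmarkov : homogeneous_markov_chain X)
    (hL2 : forall k : int, (X k : T -> R) \in Lfun P 2%:E)
    (hmean : forall k : int, ('E_P[X k] = 0)%E)
    (hvar : forall k : int, ('E_P[(fun w => X k w ^+ 2)%R] = 1)%E)
    (hr : corr X 1 != 0)
    (hr2 : 2 * `|corr X 1| < 1 + corr X 2)
    (hlin : exists a b : R, two_sided_regression X 1 (sym_lin a b))
    (hquad : exists A B C D : R, two_sided_regression X 2 (sym_quad A B C D)) :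
  exists A B C D : R,
    [/\ two_sided_regression X 2 (sym_quad A B C D),
        D = 0
      & A * (corr X 1 ^+ 2 + 1 / corr X 1 ^+ 2) + B = 1 \/
        2 * A + B * corr X 1 ^+ 2 = 1].
Proof.
have [a [b X_lin]] := hlin; have [A [B [C [D X_quad]]]] := hquad.
have X_mean k : \int[P]_w X k w = 0.
  by have := hmean k; rewrite unlock => /(congr1 fine).
have X_var k : \int[P]_w X k w ^+ 2 = 1.
  by have := hvar k; rewrite unlock => /(congr1 fine).
have [X1|free] :=
  unit_square_or_moments_free hmarkov hL2 X_mean X_var X_lin hr hr2 hstat.
  exists (1 / 2), 0, 0, 0; split => //; first exact: unit_square_regression.
  by right; field.
have [D0 coefE] :=
  quadratic_coefficients hmarkov hL2 X_mean X_var X_lin hr hr2 X_quad free.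
by exists A, B, C, D.
Qed.
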